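(* For every positive integer $n$ let $x(n)=z(n)-(r(n)+1)m(n)$, where $z(n)$, $m(n)$, $r(n)$ are as defined in the context. Then: (i) $x(n)=0$ if and only if $n\in\{436,451,529,545,546\}$. (ii) $x(n)<0$ if and only if either $n\le 435$, or $n=450$, or $513\le n\le 528$. (iii) $x(n)>0$ if and only if either $437\le n\le 512$ with $n\ne 450,451$, or $n\ge 530$ with $n\ne 545,546$. (iv) $x(n)>0$ for every $n\ge 547$. (v) The sequence $x(n)$ ($n=1,2,\dots$) has no maximal value, i.e. it is unbounded above. (vi) $x(129)=-59$ and $x(n)\ge -58$ for every positive integer $n\ne 129$.
   Context: For a positive integer $n$: $z(n)$ denotes the largest integer such that $3z(n)<2n$; $m(n)$ denotes the largest integer such that $m(n)^2\le 2n$; $r(n)$ denotes the least non-negative integer such that $n\le 2^{r(n)}$; and $x(n)=z(n)-(r(n)+1)m(n)$. *)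

(* Defs.v *)
From mathcomp Require Import all_boot all_order all_algebra.
From mathcomp Require Import zify.
Set Implicit Arguments.
Unset Strict Implicit.
Unset Printing Implicit Defensive.
Import Order.TTheory GRing.Theory Num.Theory.
Local Open Scope ring_scope.

Definition is_largest_int (P : int -> Prop) (a : int) : Prop :=
  P a /\ forall b : int, P b -> b <= a.

Definition is_least_nat (P : nat -> Prop) (a : nat) : Prop :=
  P a /\ forall b : nat, P b -> (a <= b)%N.

Definition is_z (n : nat) (z : int) : Prop :=
  is_largest_int (fun k : int => 3 * k < 2 * n%:Z) z.

Definition is_m (n : nat) (m : int) : Prop :=
  is_largest_int (fun k : int => k ^+ 2 <= 2 * n%:Z) m.

Definition is_r (n r : nat) : Prop :=
  is_least_nat (fun k : nat => (n <= 2 ^ k)%N) r.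

(* The relations above determine functions, so that quantifying over
   functions satisfying them is neither vacuous nor ambiguous. *)
Lemma is_z_total (n : nat) : exists z : int, is_z n z.
Proof.
by exists ((2 * n%:Z - 1) %/ 3)%Z; split => [|b]; lia.
Qed.

Lemma is_m_total (n : nat) : exists m : int, is_m n m.
Proof.
have ex0 : exists k, (k ^ 2 <= 2 * n)%N by exists 0%N.
have ub k : (k ^ 2 <= 2 * n)%N -> (k <= 2 * n)%N by nia.
case: (ex_maxnP ex0 ub) => m mP m_max; exists m%:Z; split=> [|b hb].
  by move: mP; rewrite expr2; nia.
have : (`|b| ^ 2 <= 2 * n)%N by move: hb; rewrite expr2; nia.
by move/m_max; lia.
Qed.

Lemma is_r_total (n : nat) : exists r : nat, is_r n r.
Proof.
have ex0 : exists k, (n <= 2 ^ k)%N by exists n; rewrite ltnW // ltn_expl.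
by case: (ex_minnP ex0) => r rP r_min; exists r; split=> // b /r_min.
Qed.

Lemma is_largest_int_inj (P : int -> Prop) (a b : int) :
  is_largest_int P a -> is_largest_int P b -> a = b.
Proof. by move=> [Pa la] [Pb lb]; apply/le_anti; rewrite la // lb. Qed.

Lemma is_least_nat_inj (P : nat -> Prop) (a b : nat) :
  is_least_nat P a -> is_least_nat P b -> a = b.
Proof. by move=> [Pa la] [Pb lb]; apply/anti_leq; rewrite la // lb. Qed.

(* Main.v *)
(* Write s = m(n) and r = r(n).  Since 3 z(n) + 3 >= 2 n >= s^2, as soon as
   s >= 3 r + 4 one gets 3 x(n) + 3 >= s (s - 3 (r + 1)) >= s.  This holds for
   n > 1024, because then (3 r + 4)^2 <= 2^r < 2 n; so x(n) is positive there
   and grows at least like s / 3.  The values n <= 1024 are computed. *)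
Require Import Defs.
From mathcomp Require Import all_boot all_order all_algebra.
From mathcomp Require Import zify.
From Stdlib Require PeanoNat.
Set Implicit Arguments.
Unset Strict Implicit.
Unset Printing Implicit Defensive.
Import Order.TTheory GRing.Theory Num.Theory.
Local Open Scope ring_scope.

Definition isqrt (n : nat) : nat := PeanoNat.Nat.sqrt n.

Definition zval (n : nat) : nat := ((2 * n).-1 %/ 3)%N.
Definition mval (n : nat) : nat := isqrt (2 * n).
Definition rval (n : nat) : nat := up_log 2 n.
(** The subtracted term of x(n), kept in [nat]: the sign of x(n) becomes a comparison of naturals
    that can be evaluated. *)
Definition cval (n : nat) : nat := ((rval n).+1 * mval n)%N.

(** Galois connection between squaring and the integer square root; at [k = isqrt n] it bounds the
    square of the root by [n]. *)
Lemma isqrt_geE (k n : nat) : (k <= isqrt n)%N = (k * k <= n)%N.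
Proof.
have [lo hi] := PeanoNat.Nat.sqrt_spec n (PeanoNat.Nat.le_0_l n).
rewrite /isqrt; move: (PeanoNat.Nat.sqrt n) lo hi => s lo hi.
by apply/idP/idP; nia.
Qed.

Lemma is_z_zval (n : nat) : (0 < n)%N -> is_z n (zval n).
Proof. by rewrite /zval => n_gt0; split=> [|b]; lia. Qed.

Lemma is_m_mval (n : nat) : is_m n (mval n).
Proof.
split=> [|b]; rewrite expr2.
  by have := isqrt_geE (mval n) (2 * n); rewrite leqnn; lia.
move=> b2_le; have : (`|b| <= mval n)%N by rewrite isqrt_geE; nia.
by lia.
Qed.

Lemma is_r_rval (n : nat) : is_r n (rval n).
Proof. by split=> [|b n_le]; [exact: up_logP | exact: up_log_min]. Qed.

(** The inequality fails at 10 (1156 > 1024) and holds at 11 (1369 <= 2048). The step uses (3r+7)^2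
    <= 2(3r+4)^2. *)
Lemma sqr_lin_le_exp2 (r : nat) :
  (11 <= r)%N -> ((3 * r + 4) * (3 * r + 4) <= 2 ^ r)%N.
Proof.
elim: r => // r IHr; rewrite leq_eqVlt => /predU1P[<- // | r_ge].
by have := IHr r_ge; rewrite expnS; nia.
Qed.

Lemma mval_ge (n : nat) : (1024 < n)%N -> (3 * rval n + 4 <= mval n)%N.
Proof.
move=> n_gt; rewrite isqrt_geE.
have r_ge : (11 <= rval n)%N.
  by rewrite -(ltn_exp2l 10 _ (isT : 1 < 2)%N) (leq_trans n_gt) ?up_logP.
have := sqr_lin_le_exp2 r_ge.
have n_gt1 : (1 < n)%N by lia.
(* Minimality of r gives 2^(r-1) < n, so (3r+4)^2 <= 2^r < 2n. *)
have /andP[] := up_log_bounds (isT : (1 < 2)%N) n_gt1.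
rewrite -/(rval n); case: (rval n) r_ge => // r _ /=.
by rewrite expnS; lia.
Qed.

Lemma mval_le_tail (n : nat) :
  (1024 < n)%N -> (3 * cval n + mval n <= 3 * zval n + 3)%N.
Proof.
move=> n_gt; have m_ge := mval_ge n_gt.
have := isqrt_geE (mval n) (2 * n); rewrite leqnn => /esym m2_le.
have z_ge : (2 * n <= 3 * zval n + 3)%N by rewrite /zval; lia.
by rewrite /cval; nia.
Qed.

(** Boolean form of (i), (ii) and the bound in (vi), so that the finite range is settled by one
    evaluation; (iii) follows by trichotomy. *)
Definition sign_spec (n : nat) : bool :=
  [&& (zval n == cval n) == (n \in [:: 436; 451; 529; 545; 546]%N),
      (zval n < cval n)%N == [|| n <= 435, n == 450 | 513 <= n <= 528]%N
    & (n != 129%N) ==> (cval n <= zval n + 58)%N].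

Lemma sign_spec_small : all sign_spec (iota 1 1024).
Proof. by vm_compute. Qed.

Lemma sign_specP (n : nat) : (0 < n)%N -> sign_spec n.
Proof.
move=> n_gt0; have [n_le | n_gt] := leqP n 1024.
  by apply: (allP sign_spec_small); rewrite mem_iota; lia.
(* Here [mval n >= 4], so 3 [cval n] + 4 <= 3 [zval n] + 3, which forces [cval n < zval n]. *)
have := mval_le_tail n_gt; have := mval_ge n_gt.
by rewrite /sign_spec !inE; lia.
Qed.

Theorem theorem1 (z m : nat -> int) (r : nat -> nat) (x : nat -> int)
    (hz : forall n : nat, (0 < n)%N -> is_z n (z n))
    (hm : forall n : nat, (0 < n)%N -> is_m n (m n))
    (hr : forall n : nat, (0 < n)%N -> is_r n (r n))
    (hx : forall n : nat, (0 < n)%N -> x n = z n - ((r n)%:Z + 1) * m n) :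
  (* (i) *)
  (forall n : nat, (0 < n)%N ->
     (x n = 0 <-> n \in [:: 436; 451; 529; 545; 546]%N)) /\
  (* (ii) *)
  (forall n : nat, (0 < n)%N ->
     (x n < 0 <->
      (n <= 435)%N \/ n = 450%N \/ (513 <= n <= 528)%N)) /\
  (* (iii) *)
  (forall n : nat, (0 < n)%N ->
     (0 < x n <->
      ((437 <= n <= 512)%N /\ n <> 450%N /\ n <> 451%N) \/
      ((530 <= n)%N /\ n <> 545%N /\ n <> 546%N))) /\
  (* (iv) *)
  (forall n : nat, (547 <= n)%N -> 0 < x n) /\
  (* (v) *)
  ((~ exists n : nat, (0 < n)%N /\
        forall k : nat, (0 < k)%N -> x k <= x n) /\
   (forall B : int, exists n : nat, (0 < n)%N /\ B < x n)) /\
  (* (vi) *)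
  (x 129%N = - 59 /\
   forall n : nat, (0 < n)%N -> n <> 129%N -> - 58 <= x n).
Proof.
(* Uniqueness identifies the given z, m, r with the computable versions on positive n. *)
have xE n : (0 < n)%N -> x n = (zval n)%:Z - (cval n)%:Z.
  move=> n_gt0; rewrite hx //.
  rewrite (is_largest_int_inj (hz n n_gt0) (is_z_zval n_gt0)).
  rewrite (is_largest_int_inj (hm n n_gt0) (is_m_mval n)).
  rewrite (is_least_nat_inj (hr n n_gt0) (is_r_rval n)).
  by rewrite /cval; lia.
have spec n : (0 < n)%N ->
    [/\ (x n == 0) = (n \in [:: 436; 451; 529; 545; 546]%N),
        (x n < 0) = [|| n <= 435, n == 450 | 513 <= n <= 528]%N
      & n <> 129%N -> - 58 <= x n].
  move=> n_gt0; rewrite xE //.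
  have /and3P[/eqP <- /eqP <- /implyP x_ge] := sign_specP n_gt0.
  split; [lia | lia | move=> /eqP /x_ge; lia].
have unbounded B : exists n : nat, (0 < n)%N /\ B < x n.
  (* The summand 1025 puts n in the tail range and k^2 <= 2n gives m(n) >= k, hence 3 x(n) + 3 >= k
     = 3(|B| + 2) and x(n) >= |B| + 1. *)
  pose k := (3 * (`|B| + 2))%N; exists (1025 + k * k)%N; split=> //.
  have := @mval_le_tail (1025 + k * k) isT.
  have : (k <= mval (1025 + k * k))%N by rewrite isqrt_geE; lia.
  by rewrite xE // /k; lia.
split; [|split; [|split; [|split; [|split]]]].
- by move=> n /spec[<- _ _]; split=> /eqP.
- by move=> n /spec[_ -> _]; lia.
- by move=> n /spec[]; rewrite !inE; lia.
- move=> n n_ge; have /spec[] : (0 < n)%N by lia.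
  by rewrite !inE; lia.
- split=> // -[n [_ n_max]]; have [k [k_gt0]] := unbounded (x n).
  by rewrite ltNge n_max.
- by split=> [|n /spec[]//]; rewrite xE.
Qed.
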